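(* Let $\mu,\nu$ be probability measures on the real line with all moments finite, and let $\widehat{\mu},\widehat{\nu}$ be the associated states on $\mathcal{B}$. Then the admissible cumulants satisfy $$L_{\widehat{\mu}\star\widehat{\nu}}(s)=L_{\widehat{\mu}}(s)+L_{\widehat{\nu}}(s)$$ for every $s\in S^{+}$, where $\widehat{\mu}\star\widehat{\nu}=(\widehat{\mu}\otimes\widehat{\nu})\circ\Delta$.
   Context: Words and admissible partitions. $S=FS(\{z,w\})$ is the free semigroup of all finite words in the letters $z,w$ including the empty word $1$; $S^{+}=S\setminus\{1\}$; $l(s)$ is the length of $s$. A subword of $s=s_1\ldots s_n$ is a subsequence $s_{i_1}\ldots s_{i_k}$, $1\le i_1<\ldots<i_k\le n$, with its indices remembered (when a function on $S$ is evaluated at a subword, the subword is regarded simply as a word). A partition of $s\in S^+$ is a sequence $u=(u_1,\ldots,u_p)$ of nonempty subwords with pairwise disjoint index sets whose union is $\{1,\ldots,n\}$, ordered by increasing first index. A letter $s_j$ of $s$ not belonging to $u_l=s_{i_1}\ldots s_{i_k}$ is inner with respect to $u_l$ if $i_1<j<i_k$. The partition $u$ is admissible if no letter equal to $w$ is inner with respect to any word $u_l$ of $u$ to which it does not belong. $\mathcal{AP}(s)$ is the set of admissible partitions of $s$. The bialgebra. $\mathcal{B}=\mathbf{C}\langle X,X',P\rangle$ is the unital *-algebra of polynomials in noncommuting self-adjoint $X,X'$ and a projection $P$ ($P^*=P^2=P$), with coproduct the unital *-homomorphism $\Delta:\mathcal{B}\to\mathcal{B}\otimes\mathcal{B}$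 given by $\Delta(X)=X\otimes 1+1\otimes X$, $\Delta(X')=X'\otimes P+P\otimes X'$, $\Delta(P)=P\otimes P$. Write $X(z)=X$, $X(w)=X'$. States from measures. For a probability measure $\mu$ on $\mathbf{R}$ with all moments finite, with moments $\mu_n$, let $\phi$ be the state on $\mathbf{C}[Y]$ ($Y=Y^*$) with $\phi(Y^n)=\mu_n$. Its boolean extension $\widetilde{\phi}$ is the state on $\mathbf{C}\langle Y,P\rangle$ ($P$ a projection) given by $\widetilde{\phi}(P^{\alpha}Y^{n_1}PY^{n_2}P\cdots PY^{n_k}P^{\beta})=\phi(Y^{n_1})\cdots\phi(Y^{n_k})$ for $\alpha,\beta\in\{0,1\}$, $n_i\in\mathbf{N}$, and $\widetilde{\phi}(P)=1$. Let $\eta:\mathcal{B}\to\mathbf{C}\langle Y,P\rangle$ be the unital *-homomorphism with $\eta(X)=\eta(X')=Y$, $\eta(P)=P$. Then $\widehat{\mu}:=\widetilde{\phi}\circ\eta$; $\widehat{\nu}$ is defined from $\nu$ in the same way. Moments and cumulants. For a state $\widehat{\phi}$ on $\mathcal{B}$, $M_{\widehat{\phi}}(s)=\widehat{\phi}(X(s_1)\cdots X(s_n))$ for $s=s_1\ldots s_n\in S^+$, and $M_{\widehat\phi}(1)=1$. The admissible cumulants $(L_{\widehat{\phi}}(s))_{s\in S^+}$ are defined recursively by $M_{\widehat{\phi}}(s)=\sum_{p=1}^{l(s)}\sum_{u=(u_1,\ldots,u_p)\in\mathcal{AP}(s)}L_{\widehat{\phi}}(u_1)\cdots L_{\widehat{\phi}}(u_p)$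 for all $s\in S^+$. *)

(* Defs.v *)
From HB Require Import structures.
From mathcomp Require Import all_classical all_reals all_analysis.
From mathcomp Require Import all_boot all_order all_algebra.
From mathcomp Require Import complex finmap.
(* Notations of monalg are left out: they clash with those of analysis. *)
From mathcomp Require Import -(notations) monalg.

Set Implicit Arguments.
Unset Strict Implicit.
Unset Printing Implicit Defensive.

Import GRing.Theory.

Local Open Scope ring_scope.

(* [malg K C], with the [algType] structure that monalg only provides for a
   commutative monoid [K]. *)
Definition monoid_algebra (C : comNzRingType) (K : MonomialDef.type) : Type :=
  malg K C.

HB.instance Definition _ (C : comNzRingType) (K : MonomialDef.type) :=
  GRing.Lalgebra.copy (monoid_algebra C K) (malg K C).

(* Locked, as is [lin_ext] below, to prevent expensive conversions. *)
HB.lock Definition monom (C : comNzRingType) (K : MonomialDef.type) (k : K) :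
  monoid_algebra C K := mkmalgU k 1.

Section MonoidAlgebra.
Variables (C : comNzRingType) (K : MonomialDef.type).

Local Notation monom := (@monom C K).

Lemma monomE k : monom k = mkmalgU k 1. Proof. by rewrite monom.unlock. Qed.

Lemma mkmalgUZ (c d : C) (k : K) :
  c *: (mkmalgU k d : monoid_algebra C K) = mkmalgU k (c * d).
Proof.
by apply/malgP => l; rewrite (@mcoeffZ K C) !(@mcoeffU K C) mulrnAr.
Qed.

Lemma malg_monomE (a : monoid_algebra C K) :
  a = \sum_(k <- msupp a) mcoeff k a *: monom k.
Proof.
by rewrite [LHS](monalgE a); apply: eq_bigr => k _; rewrite monomE mkmalgUZ mulr1.
Qed.

Lemma monom1 : monom mone = 1. Proof. exact: monomE. Qed.

Lemma monomM k l : monom (mmul k l) = monom k * monom l.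
Proof. by rewrite !monomE [RHS](@fgmulUU K C) mulr1. Qed.

Lemma monoid_algebra_scalerAr (c : C) (a b : monoid_algebra C K) :
  c *: (a * b) = a * (c *: b).
Proof.
rewrite [RHS](malgMEw (fsubset_refl (msupp a)) (msuppZ_le c b)).
rewrite malgME scaler_sumr; apply: eq_bigr => k _.
rewrite scaler_sumr; apply: eq_bigr => l _.
by rewrite mkmalgUZ mcoeffZ mulrCA.
Qed.

End MonoidAlgebra.

Arguments monom C {K} k.

HB.instance Definition _ (C : comNzRingType) (K : MonomialDef.type) :=
  GRing.Lalgebra_isAlgebra.Build C (monoid_algebra C K)
    (@monoid_algebra_scalerAr C K).

HB.lock Definition lin_ext (C : comNzRingType) (K : MonomialDef.type)
    (V : lmodType C) (h : K -> V) (a : monoid_algebra C K) : V :=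
  \sum_(k <- msupp a) mcoeff k a *: h k.
Arguments lin_ext {C K V} h a.

Section LinearExtension.
Variables (C : comNzRingType) (K : MonomialDef.type).

Lemma lin_extE (V : lmodType C) (h : K -> V) (a : monoid_algebra C K) :
  lin_ext h a = \sum_(k <- msupp a) mcoeff k a *: h k.
Proof. by rewrite lin_ext.unlock. Qed.

Lemma lin_extEw (V : lmodType C) (h : K -> V) (d : {fset K})
    (a : monoid_algebra C K) :
  (msupp a `<=` d)%fset -> lin_ext h a = \sum_(k <- d) mcoeff k a *: h k.
Proof.
move=> le; rewrite lin_extE (big_fset_incl _ le) => //= k _ /mcoeff_outdom ->.
by rewrite scale0r.
Qed.

Lemma lin_ext_is_linear (V : lmodType C) (h : K -> V) : linear (lin_ext h).
Proof.
move=> c a b; pose d := (msupp (c *: a + b) `|` (msupp a `|` msupp b))%fset.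
rewrite !(@lin_extEw _ _ d) ?fsubsetUl //; last 2 first.
- by rewrite /d; apply/fsubsetP => k; rewrite !inE => ->; rewrite !orbT.
- by rewrite /d; apply/fsubsetP => k; rewrite !inE => ->; rewrite !orbT.
rewrite scaler_sumr -big_split /=; apply: eq_bigr => k _.
by rewrite (@mcoeffD K C) (@mcoeffZ K C) scalerDl scalerA.
Qed.

HB.instance Definition _ (V : lmodType C) (h : K -> V) :=
  GRing.isLinear.Build C (monoid_algebra C K) V *:%R (lin_ext h)
    (lin_ext_is_linear h).

Lemma lin_ext_monom (V : lmodType C) (h : K -> V) k :
  lin_ext h (monom C k) = h k.
Proof.
rewrite (@lin_extEw _ _ [fset k]%fset) monomE ?msuppU_le //.
by rewrite big_seq_fset1 (@mcoeffUU K C) scale1r.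
Qed.

Lemma lin_ext_unique (V : lmodType C) (h : K -> V)
    (f : {linear monoid_algebra C K -> V}) :
  (forall k, f (monom C k) = h k) -> f =1 lin_ext h.
Proof.
move=> fE a; rewrite lin_extE {1}(malg_monomE a) linear_sum; apply: eq_bigr => k _.
by rewrite linearZ /= fE.
Qed.

Lemma lin_ext_monoid_morphism (A : algType C) (h : K -> A) :
  h mone = 1 -> (forall k l, h (mmul k l) = h k * h l) ->
  monoid_morphism (lin_ext h).
Proof.
move=> h1 hM; split=> [|a b]; first by rewrite -monom1 lin_ext_monom.
rewrite {1}(malg_monomE a) {1}(malg_monomE b) mulr_suml linear_sum /=.
rewrite [X in _ = X * _]lin_extE [RHS]mulr_suml; apply: eq_bigr => k _.
rewrite [X in _ = _ * X]lin_extE !mulr_sumr linear_sum /=; apply: eq_bigr => l _.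
rewrite -!(scalerAl, scalerAr) -monomM !linearZ /= lin_ext_monom hM.
by rewrite !scalerA mulrC.
Qed.

End LinearExtension.

Section ProductMonoid.
Variables K L : MonomialDef.type.
Implicit Types x y : (K * L)%type.

Definition pair_mul x y : K * L := (mmul x.1 y.1, mmul x.2 y.2).

Lemma pair_mulA : associative pair_mul.
Proof. by move=> x y t; rewrite /pair_mul !mulmA. Qed.
Lemma pair_mul1m : left_id (mone, mone) pair_mul.
Proof. by move=> [k l]; rewrite /pair_mul !mul1m. Qed.
Lemma pair_mulm1 : right_id (mone, mone) pair_mul.
Proof. by move=> [k l]; rewrite /pair_mul !mulm1. Qed.
Lemma pair_mul_unit x y : pair_mul x y = (mone, mone) ->
  x = (mone, mone) /\ y = (mone, mone).
Proof.
by case: x y => [k l] [k' l'] [/unitm[-> ->] /unitm[-> ->]].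
Qed.

HB.instance Definition _ := Choice_isMonomialDef.Build (K * L)%type
  pair_mulA pair_mul1m pair_mulm1 pair_mul_unit.

End ProductMonoid.

(* The tensor product of the algebras of the monoids K and L is the algebra of
   the monoid K * L, the monomial (k, l) standing for the tensor k (x) l. *)
Definition tensor_algebra (C : comNzRingType) (K L : MonomialDef.type) :=
  monoid_algebra C (K * L)%type.

Section Tensor.
Variables (C : comNzRingType) (K L : MonomialDef.type).
Implicit Types (a : monoid_algebra C K) (b : monoid_algebra C L).

Definition tens a b : tensor_algebra C K L :=
  lin_ext (fun k => lin_ext (fun l => monom C (k, l)) b) a.

Lemma tens_linearl b : linear (tens^~ b).
Proof. by move=> c a1 a2; rewrite /tens linearP. Qed.

Lemma tens_linearr a : linear (tens a).
Proof.
move=> c b1 b2; rewrite /tens !lin_extE scaler_sumr -big_split /=.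
apply: eq_bigr => k _; rewrite linearP.
by rewrite scalerDr !scalerA [mcoeff _ _ * c]mulrC.
Qed.

Lemma tens_monom k l : tens (monom C k) (monom C l) = monom C (k, l).
Proof. by rewrite /tens !lin_ext_monom. Qed.

HB.instance Definition _ a := GRing.isLinear.Build C _ _ *:%R (tens a)
  (tens_linearr a).

Lemma tens1 : tens 1 1 = 1.
Proof. by rewrite -!monom1 tens_monom. Qed.

End Tensor.

Section TensorTheory.
Variables (C : comNzRingType) (K L : MonomialDef.type).
Implicit Types (a : monoid_algebra C K) (b : monoid_algebra C L).

Let tensr b a : tensor_algebra C K L := tens a b.

HB.instance Definition _ b := GRing.isLinear.Build C _ _ *:%R (tensr b)
  (tens_linearl b).

Lemma tens_suml (I : Type) (r : seq I) (F : I -> monoid_algebra C K) b :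
  tens (\sum_(i <- r) F i) b = \sum_(i <- r) tens (F i) b.
Proof. exact: (linear_sum (tensr b)). Qed.

Lemma tensZl c a b : tens (c *: a) b = c *: tens a b.
Proof. exact: (linearZ_LR (tensr b)). Qed.

Lemma tensE a b : tens a b =
  \sum_(k <- msupp a) \sum_(l <- msupp b)
    (mcoeff k a * mcoeff l b) *: monom C (k, l).
Proof.
rewrite /tens lin_extE; apply: eq_bigr => k _.
by rewrite lin_extE scaler_sumr; apply: eq_bigr => l _; rewrite scalerA.
Qed.

Lemma tensM a a' b b' : tens a b * tens a' b' = tens (a * a') (b * b').
Proof.
rewrite (malg_monomE a) [X in X * _]tens_suml [LHS]mulr_suml.
rewrite [X in _ = tens X _]mulr_suml [RHS]tens_suml; apply: eq_bigr => k _.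
rewrite tensZl -[LHS]scalerAl -[X in _ = tens X _]scalerAl [RHS]tensZl.
congr (_ *: _); rewrite (malg_monomE a') [X in _ * X]tens_suml [LHS]mulr_sumr.
rewrite [X in _ = tens X _]mulr_sumr [RHS]tens_suml; apply: eq_bigr => k' _.
rewrite tensZl -[LHS]scalerAr -[X in _ = tens X _]scalerAr [RHS]tensZl.
congr (_ *: _); rewrite (malg_monomE b) [X in X * _]linear_sum [LHS]mulr_suml.
rewrite [X in _ = tens _ X]mulr_suml [RHS]linear_sum; apply: eq_bigr => l _.
rewrite linearZ -[LHS]scalerAl -[X in _ = tens _ X]scalerAl [RHS]linearZ.
congr (_ *: _); rewrite (malg_monomE b') [X in _ * X]linear_sum [LHS]mulr_sumr.
rewrite [X in _ = tens _ X]mulr_sumr [RHS]linear_sum; apply: eq_bigr => l' _.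
rewrite linearZ -[LHS]scalerAr -[X in _ = tens _ X]scalerAr [RHS]linearZ.
by congr (_ *: _); rewrite /= -!monomM !tens_monom -monomM.
Qed.

Definition tens_fun (phi : monoid_algebra C K -> C)
    (psi : monoid_algebra C L -> C) : tensor_algebra C K L -> C :=
  lin_ext (V := C^o) (fun kl => phi (monom C kl.1) * psi (monom C kl.2)).

Lemma tens_funE (phi : {linear monoid_algebra C K -> C^o})
    (psi : {linear monoid_algebra C L -> C^o}) a b :
  tens_fun phi psi (tens a b) = phi a * psi b.
Proof.
rewrite tensE /tens_fun; set h := fun kl => _.
rewrite (linear_sum (lin_ext (V := C^o) h)) [in RHS](malg_monomE a).
rewrite (linear_sum phi) mulr_suml; apply: eq_bigr => k _.
rewrite (linear_sum (lin_ext (V := C^o) h)) [in RHS](malg_monomE b).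
rewrite (linear_sum psi) mulr_sumr; apply: eq_bigr => l _.
rewrite linearZ /= lin_ext_monom (linearZ_LR phi) (linearZ_LR psi) /h /=.
exact: (mulrACA (mcoeff k a) (mcoeff l b) (phi (monom C k)) _).
Qed.

End TensorTheory.

(* The monoid presented by generators Y_i (i : I) and P with the relation
   P * P = P.  [Some i] stands for Y_i and [None] for P; an element is
   represented by its unique word without two consecutive letters P. *)
Section ProjectionMonoid.
Variable I : choiceType.
Implicit Types (a : option I) (s t u : seq (option I)).

Definition reduced s := sorted [rel a b : option I | isSome a || isSome b] s.

Definition pcons a s :=
  if (a, s) is (None, None :: _) then s else a :: s.

Definition reduce s := foldr pcons [::] s.

Lemma reduced_pcons a s : reduced s -> reduced (pcons a s).
Proof. by case: a s => [a|] [|[b|] s]. Qed.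

Lemma reduced_foldr s t : reduced t -> reduced (foldr pcons t s).
Proof. by move=> tP; elim: s => //= a s IHs; apply: reduced_pcons. Qed.

Lemma reduced_reduce s : reduced (reduce s).
Proof. exact: reduced_foldr. Qed.

Lemma reduce_id s : reduced s -> reduce s = s.
Proof.
elim: s => //= a s IHs; rewrite /reduced /= => sP.
rewrite IHs; last by apply: path_sorted sP.
by case: a s sP {IHs} => [a|] [|[b|] s].
Qed.

Lemma foldr_pcons_reduce s t : foldr pcons t (reduce s) = foldr pcons t s.
Proof.
elim: s => //= a s IHs; rewrite -{}IHs; case: a (reduce s) => [a|] [|[b|] r] //=.
by case: (foldr pcons t r) => [|[c|] q].
Qed.

Lemma reduce_cat s t : reduce (s ++ t) = foldr pcons (reduce t) s.
Proof. exact: foldr_cat. Qed.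

Lemma reduce_catl s t : reduce (reduce s ++ t) = reduce (s ++ t).
Proof. by rewrite !reduce_cat foldr_pcons_reduce. Qed.

Lemma reduce_catr s t : reduce (s ++ reduce t) = reduce (s ++ t).
Proof. by rewrite !reduce_cat reduce_id ?reduced_reduce. Qed.

Definition pmonom := {s : seq (option I) | reduced s}.

Definition pmon s : pmonom := exist _ (reduce s) (reduced_reduce s).

Definition pmon_mul (m n : pmonom) : pmonom := pmon (val m ++ val n).

Lemma pmon_mulA : associative pmon_mul.
Proof.
by move=> m n p; apply: val_inj; rewrite /= reduce_catl reduce_catr catA.
Qed.

Lemma pmon_mul1 : left_id (pmon [::]) pmon_mul.
Proof. by move=> m; apply: val_inj; rewrite /= reduce_id ?(valP m). Qed.

Lemma pmon_mulr1 : right_id (pmon [::]) pmon_mul.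
Proof.
by move=> m; apply: val_inj; rewrite /= cats0 reduce_id ?(valP m).
Qed.

Lemma pmon_mul_unit m n :
  pmon_mul m n = pmon [::] -> m = pmon [::] /\ n = pmon [::].
Proof.
have nil s : reduce s = [::] -> s = [::].
  by case: s => [|a s] //=; case: a (reduce s) => [a|] [|[b|] r].
move=> /(congr1 val) /= /nil; case: m n => [[|a m] mP] [[|b n] nP] //= _.
by split; apply: val_inj.
Qed.

HB.instance Definition _ := Choice.on pmonom.
HB.instance Definition _ := Choice_isMonomialDef.Build pmonom
  pmon_mulA pmon_mul1 pmon_mulr1 pmon_mul_unit.

Lemma pmonM s t : pmon (s ++ t) = mmul (pmon s) (pmon t).
Proof. by apply: val_inj; rewrite /= reduce_catl reduce_catr. Qed.

End ProjectionMonoid.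

(* C<Y_i (i : I), P> with P * P = P, as the algebra of the monoid above. *)
Definition ncpoly (C : comNzRingType) (I : choiceType) :=
  monoid_algebra C (pmonom I).

Section Ncpoly.
Variables (C : comNzRingType) (I : choiceType).

Definition ncvar (i : I) : ncpoly C I := monom C (pmon [:: Some i]).
Definition ncproj : ncpoly C I := monom C (pmon [:: None]).

Lemma ncproj_idem : ncproj * ncproj = ncproj.
Proof. by rewrite /ncproj -monomM -pmonM; congr monom; apply: val_inj. Qed.

Lemma monom_pmon (s : seq (option I)) :
  monom C (pmon s) = \prod_(a <- s) oapp ncvar ncproj a.
Proof.
elim: s => [|a s IHs]; first by rewrite big_nil -monom1.
by rewrite big_cons -IHs -cat1s pmonM monomM; case: a.
Qed.

(* The algebra morphism mapping Y_i to [x i] and P to [p]; it is one as soon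
   as [p] is idempotent. *)
Definition ncmorph (A : algType C) (x : I -> A) (p : A) : ncpoly C I -> A :=
  lin_ext (fun m : pmonom I => \prod_(a <- val m) oapp x p a).

Section Morphism.
Variables (A : algType C) (x : I -> A) (p : A).
Hypothesis p_idem : p * p = p.

Lemma ncmorph_pmon (s : seq (option I)) :
  ncmorph x p (monom C (pmon s)) = \prod_(a <- s) oapp x p a.
Proof.
rewrite /ncmorph lin_ext_monom /=; elim: s => //= a s IHs.
rewrite [RHS]big_cons -IHs.
case: a (reduce s) => [a|] [|[b|] r] /=; rewrite ?big_cons ?big_nil //=.
by rewrite mulrA p_idem.
Qed.

Lemma ncmorph_monoid_morphism : monoid_morphism (ncmorph x p).
Proof.
apply: lin_ext_monoid_morphism => [|k l]; first by rewrite /= big_nil.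
rewrite -big_cat /=; have := ncmorph_pmon (val k ++ val l).
by rewrite /ncmorph lin_ext_monom.
Qed.

Lemma ncmorph_var i : ncmorph x p (ncvar i) = x i.
Proof. by rewrite ncmorph_pmon big_seq1. Qed.

Lemma ncmorph_proj : ncmorph x p ncproj = p.
Proof. by rewrite ncmorph_pmon big_seq1. Qed.

Lemma ncmorph_unique (f : {lrmorphism ncpoly C I -> A}) :
  (forall i, f (ncvar i) = x i) -> f ncproj = p -> f =1 ncmorph x p.
Proof.
move=> fx fp; apply: lin_ext_unique => -[s sP] /=.
have -> : exist _ s sP = pmon s by apply: val_inj; rewrite /= reduce_id.
rewrite monom_pmon rmorph_prod; apply: eq_bigr => -[i|] _ /=; first exact: fx.
exact: fp.
Qed.

End Morphism.

End Ncpoly.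

Arguments ncproj {C I}.
Arguments ncvar {C I}.

Variant letter := Lz | Lw.

Definition letter_bool (x : letter) := if x is Lw then true else false.
Definition bool_letter (b : bool) := if b then Lw else Lz.
Lemma letter_boolK : cancel letter_bool bool_letter. Proof. by case. Qed.
HB.instance Definition _ := Countable.copy letter (can_type letter_boolK).

(* C<X, X', P>, with [ncvar Lz] for X = X(z), [ncvar Lw] for X' = X(w) and
   [ncproj] for P. *)
Definition bialg (C : comNzRingType) := ncpoly C letter.
Definition bialg2 (C : comNzRingType) :=
  tensor_algebra C (pmonom letter) (pmonom letter).

Section Bialgebra.
Variable C : comNzRingType.

Definition coproduct_gen (x : letter) : bialg2 C :=
  match x with
  | Lz => tens (ncvar Lz) 1 + tens 1 (ncvar Lz)
  | Lw => tens (ncvar Lw) ncproj + tens ncproj (ncvar Lw)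
  end.

Definition coproduct : bialg C -> bialg2 C :=
  ncmorph coproduct_gen (tens ncproj ncproj).

Lemma coproduct_proj_idem :
  tens ncproj ncproj * tens ncproj ncproj = tens ncproj ncproj :> bialg2 C.
Proof. by rewrite tensM ncproj_idem. Qed.

HB.instance Definition _ := GRing.Linear.on coproduct.
HB.instance Definition _ := GRing.isMonoidMorphism.Build _ _ coproduct
  (ncmorph_monoid_morphism coproduct_gen coproduct_proj_idem).

Definition convolution (phi psi : bialg C -> C) : bialg C -> C :=
  tens_fun phi psi \o coproduct.

Definition moment_of (phi : bialg C -> C) (s : seq letter) : C :=
  phi (\prod_(x <- s) ncvar x).

(* C<Y, P> *)
Definition ncpolyY := ncpoly C unit.

Definition eta : bialg C -> ncpolyY := ncmorph (fun=> ncvar tt) ncproj.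

HB.instance Definition _ := GRing.Linear.on eta.
HB.instance Definition _ := GRing.isMonoidMorphism.Build _ _ eta
  (ncmorph_monoid_morphism _ (@ncproj_idem C unit)).

(* Lengths of the blocks of letters Y between consecutive letters P, including
   the possibly empty blocks before the first P and after the last one. *)
Definition blocks (s : seq (option unit)) : seq nat :=
  foldr (fun a r => if a is Some _ then (head 0%N r).+1 :: behead r else 0%N :: r)
    [:: 0%N] s.

(* On the word P^alpha Y^n_1 P ... P Y^n_k P^beta the value is
   phi(Y^n_1) ... phi(Y^n_k), see [boolean_extE]; the empty end blocks that
   [blocks] adds when alpha or beta is 1 contribute phi(1) = 1. *)
Definition boolean_ext (phi : {poly C} -> C) : ncpolyY -> C :=
  lin_ext (V := C^o) (fun m : pmonom unit =>
    \prod_(n <- blocks (val m)) phi 'X^n).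

End Bialgebra.

Section BooleanExtension.
Variables (C : comNzRingType) (phi : {poly C} -> C).
Hypothesis phi1 : phi 1 = 1.

Let prod_blocks s : \prod_(n <- blocks s) phi 'X^n =
  phi 'X^(head 0%N (blocks s)) * \prod_(n <- behead (blocks s)) phi 'X^n.
Proof. by case: s => [|[a|] s] /=; rewrite big_cons. Qed.

Let prod_blocksP s :
  \prod_(n <- blocks (None :: s)) phi 'X^n = \prod_(n <- blocks s) phi 'X^n.
Proof. by rewrite big_cons expr0 phi1 mul1r. Qed.

Lemma boolean_ext_pmon (s : seq (option unit)) :
  boolean_ext phi (monom C (pmon s)) = \prod_(n <- blocks s) phi 'X^n.
Proof.
rewrite /boolean_ext lin_ext_monom /=.
suff [hE tE] : head 0%N (blocks (reduce s)) = head 0%N (blocks s) /\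
    \prod_(n <- behead (blocks (reduce s))) phi 'X^n =
    \prod_(n <- behead (blocks s)) phi 'X^n by rewrite !prod_blocks hE tE.
elim: s => //= -[a|] s [IHh IHt] /=; first by rewrite IHh.
rewrite prod_blocks -{}IHh -{}IHt -prod_blocks.
by case: (reduce s) => [|[b|] r] //=; rewrite -/(blocks _) prod_blocksP.
Qed.

Lemma boolean_extE (alpha beta : bool) (n : nat) (ns : seq nat) :
  boolean_ext phi (ncproj ^+ alpha *
    (ncvar tt ^+ n * \prod_(k <- ns) (ncproj * ncvar tt ^+ k)) *
    ncproj ^+ beta) = phi 'X^n * \prod_(k <- ns) phi 'X^k.
Proof.
pose t := flatten [seq None :: nseq k (Some tt) | k <- ns] ++ nseq beta None.
have prodX (a : option unit) k :
    \prod_(b <- nseq k a) oapp ncvar ncproj b = oapp ncvar ncproj a ^+ k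
    :> ncpolyY C by rewrite big_nseq -Monoid.iteropE.
transitivity
    (boolean_ext phi (monom C (pmon (nseq alpha None ++ nseq n (Some tt) ++ t)))).
  congr boolean_ext; rewrite monom_pmon !big_cat big_flatten big_map /=.
  rewrite !prodX -!mulrA; congr (_ * (_ * (_ * _))).
  by apply: eq_bigr => k _; rewrite big_cons prodX.
have prodY k s : head 0%N (blocks s) = 0%N ->
    \prod_(m <- blocks (nseq k (Some tt) ++ s)) phi 'X^m =
    phi 'X^k * \prod_(m <- blocks s) phi 'X^m.
  move=> hs; rewrite !prod_blocks hs expr0 phi1 mul1r; congr (phi 'X^_ * _).
    elim: k => [|k IHk] /=; last by rewrite -/(blocks _) IHk.
    exact: hs.
  by elim: k => //= k <-.
rewrite boolean_ext_pmon.
have [ht pt] : head 0%N (blocks t) = 0%N /\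
    \prod_(m <- blocks t) phi 'X^m = \prod_(k <- ns) phi 'X^k.
  rewrite /t; elim: ns {t} => [|k ks [IHh IHp]] /=.
    by case: (beta); rewrite /= !big_cons !big_nil expr0 phi1 !mulr1.
  by rewrite -catA -/(blocks _) prod_blocksP prodY // IHp big_cons.
by case: alpha => /=; rewrite -/(blocks _) ?prod_blocksP prodY // pt.
Qed.

End BooleanExtension.

Section Partitions.
Variable n : nat.
Implicit Types (A : {set 'I_n}) (j : 'I_n).

Definition first_index A : nat := \big[minn/n]_(i in A) (i : nat).
Definition last_index A : nat := (\max_(i in A) i)%N.

Definition inner j A := (j \notin A) && (first_index A < j < last_index A)%N.

(* A partition of a word of length n, as the sequence of the index sets of its
   subwords. *)
Definition is_partition (u : seq {set 'I_n}) :=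
  partition [set:: u] [set: 'I_n]%SET &&
  sorted (fun A B => first_index A < first_index B)%N u.

End Partitions.

Definition subword (s : seq letter) (A : {set 'I_(size s)}) : seq letter :=
  [seq tnth (in_tuple s) i | i <- enum A].

Definition admissible (s : seq letter) (u : seq {set 'I_(size s)}) :=
  is_partition u &&
  all (fun A => [forall j, (tnth (in_tuple s) j == Lw) ==> ~~ inner j A]) u.

Definition AP (s : seq letter) (p : nat) : {set p.-tuple {set 'I_(size s)}} :=
  [set u : p.-tuple {set 'I_(size s)} | admissible u]%SET.

Section Cumulants.
Variable C : comNzRingType.

Definition is_cumulants (M L : seq letter -> C) :=
  forall s, s <> [::] -> M s =
    \sum_(1 <= p < (size s).+1) \sum_(u in AP s p)
      \prod_(l < p) L (subword (tnth u l)).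

(* The only partition with p = 1 is (s), so that the moment-cumulant formula
   gives L s in terms of the values of L at shorter words, which occur in the
   terms with p >= 2. The argument [k] bounds the depth of the recursion. *)
Fixpoint cumulant_rec (M : seq letter -> C) (k : nat) (s : seq letter) : C :=
  if k is k'.+1 then
    M s - \sum_(2 <= p < (size s).+1) \sum_(u in AP s p)
      \prod_(l < p) cumulant_rec M k' (subword (tnth u l))
  else 0.

Definition cumulant (M : seq letter -> C) (s : seq letter) : C :=
  cumulant_rec M (size s) s.

Lemma size_subword (s : seq letter) (A : {set 'I_(size s)}) :
  size (subword A) = #|A|.
Proof. by rewrite size_map -cardE. Qed.

Lemma AP_block_neq0 (s : seq letter) p (u : p.-tuple {set 'I_(size s)}) l :
  u \in AP s p -> tnth u l != set0.
Proof.
rewrite inE => /andP[/andP[/and3P[_ _ u0] _] _].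
by apply: contraNneq u0 => <-; rewrite inE mem_tnth.
Qed.

Lemma AP_block_lt (s : seq letter) p (u : p.-tuple {set 'I_(size s)}) l :
  (1 < p)%N -> u \in AP s p -> (#|tnth u l| < size s)%N.
Proof.
move=> p1 uP; have := uP.
rewrite inE => /andP[/andP[/and3P[_ ut _] us] _].
have [l' l'l] : exists l', l' != l.
  pose l0 := Ordinal (ltnW p1); pose l1 := Ordinal p1.
  by have [->|] := eqVneq l l0; [exists l1 | exists l0; rewrite eq_sym].
have uu : uniq u.
  by apply: (sorted_uniq _ _ us) => [A B D|A]; [exact: ltn_trans|exact: ltnn].
have /set0Pn [i il'] := AP_block_neq0 l' uP.
have il : i \notin tnth u l.
  apply: contraTN il' => il; have /trivIsetP/(_ (tnth u l) (tnth u l')) := ut.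
  rewrite !inE !mem_tnth => /(_ isT isT).
  rewrite !(tnth_nth set0) nth_uniq ?size_tuple // eq_sym l'l => /(_ isT).
  by rewrite -!tnth_nth => /disjointFr /(_ il) ->.
have := subset_leq_card (subsetT (i |: tnth u l)).
by rewrite cardsU1 il cardsT card_ord.
Qed.

Lemma AP1 (s : seq letter) : s <> [::] -> AP s 1 = [set [tuple [set: 'I_(size s)]%SET]]%SET.
Proof.
move=> s0; have s_gt0 : (0 < size s)%N by case: s s0.
apply/setP => u; rewrite !inE; apply/idP/eqP => [|->].
  case/tupleP: u => A u; rewrite tuple0 => /andP[/andP[/and3P[/eqP uT _ _] _] _].
  apply: val_inj => /=; congr [:: _]; rewrite -uT /cover.
  by rewrite (_ : [set:: _] = [set A])%SET ?big_set1 //; apply/setP=> B; rewrite !inE.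
pose i : 'I_(size s) := Ordinal s_gt0.
rewrite /admissible /is_partition /= !andbT; apply/andP; split.
  have -> : [set:: [:: [set: 'I_(size s)]]]%SET = [set [set: 'I_(size s)]]%SET.
    by apply/setP=> B; rewrite !inE.
  apply/and3P; split; rewrite ?inE.
  - by rewrite /cover big_set1.
  - by apply/trivIsetP => A B /set1P -> /set1P ->; rewrite eqxx.
  - by rewrite eq_sym; apply/set0Pn; exists i; rewrite inE.
by apply/forallP => j; rewrite /inner inE /= implybT.
Qed.

Lemma subwordT (s : seq letter) : subword [set: 'I_(size s)]%SET = s.
Proof.
rewrite /subword (_ : enum _ = enum 'I_(size s)); last first.
  by apply: eq_enum => i; rewrite inE.
by rewrite -[map _ _]/(val (map_tuple _ (ord_tuple _))) /= map_tnth_enum.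
Qed.

Lemma cumulant_rec_size (M : seq letter -> C) k k' s : s <> [::] ->
  (size s <= k)%N -> (size s <= k')%N ->
  cumulant_rec M k s = cumulant_rec M k' s.
Proof.
elim: k k' s => [|k IHk] [|k'] s s0 //=; first by case: s s0.
- by case: s s0.
- move=> sk sk'; congr (_ - _); apply: eq_big_nat => p /andP[p1 _].
  apply: eq_bigr => u uP; apply: eq_bigr => l _.
  have lt := AP_block_lt l p1 uP; rewrite -size_subword in lt.
  apply: IHk; rewrite -1?ltnS ?(leq_trans lt) //.
  move=> /(congr1 size)/eqP; rewrite size_subword cards_eq0.
  by rewrite (negPf (AP_block_neq0 l uP)).
Qed.

Lemma cumulantE (M : seq letter -> C) s : s <> [::] -> cumulant M s =
  M s - \sum_(2 <= p < (size s).+1) \sum_(u in AP s p)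
    \prod_(l < p) cumulant M (subword (tnth u l)).
Proof.
move=> s0; rewrite /cumulant (@cumulant_rec_size _ _ (size s).+1) //=.
congr (_ - _); apply: eq_big_nat => p /andP[p1 _].
apply: eq_bigr => u uP; apply: eq_bigr => l _; apply: cumulant_rec_size => //.
  move=> /(congr1 size)/eqP; rewrite size_subword cards_eq0.
  by rewrite (negPf (AP_block_neq0 l uP)).
by rewrite size_subword ltnW // (AP_block_lt l p1 uP).
Qed.

Lemma AP_split (L : seq letter -> C) s : s <> [::] ->
  \sum_(1 <= p < (size s).+1) \sum_(u in AP s p)
    \prod_(l < p) L (subword (tnth u l)) =
  L s + \sum_(2 <= p < (size s).+1) \sum_(u in AP s p)
    \prod_(l < p) L (subword (tnth u l)).
Proof.
move=> s0; rewrite big_ltn; last by case: s s0.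
by rewrite AP1 // big_set1 big_ord1 (tnth_nth set0) /= subwordT.
Qed.

Lemma cumulantP (M : seq letter -> C) : is_cumulants M (cumulant M).
Proof.
by move=> s s0; rewrite AP_split // {1}cumulantE // subrK.
Qed.

Lemma cumulant_unique (M L : seq letter -> C) :
  is_cumulants M L -> forall s, s <> [::] -> L s = cumulant M s.
Proof.
move=> ML s; have [k] := ubnP (size s); elim: k s => // k IHk s sk s0.
rewrite cumulantE // (ML s s0) AP_split // -[LHS](addrK (\sum_(2 <= p < (size s).+1)
  \sum_(u in AP s p) \prod_(l < p) L (subword (tnth u l)))); congr (_ - _).
apply: eq_big_nat => p /andP[p1 _].
apply: eq_bigr => u uP; apply: eq_bigr => l _; apply: IHk.
  by rewrite size_subword (leq_trans (AP_block_lt l p1 uP)).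
move=> /(congr1 size)/eqP; rewrite size_subword cards_eq0.
by rewrite (negPf (AP_block_neq0 l uP)).
Qed.

End Cumulants.

Section Star.
Variables (R : realType) (K : MonomialDef.type).
Implicit Types a b : monoid_algebra R[i] K.

(* The conjugate-linear extension of [j]. *)
Definition star_ext (j : K -> K) a : monoid_algebra R[i] K :=
  \sum_(k <- msupp a) conjc (mcoeff k a) *: monom R[i] (j k).

Variable j : K -> K.

Lemma star_ext_antilinear (c : R[i]) a b :
  star_ext j (c *: a + b) = conjc c *: star_ext j a + star_ext j b.
Proof.
pose d := (msupp (c *: a + b) `|` (msupp a `|` msupp b))%fset.
have Ew e : (msupp e `<=` d)%fset ->
    star_ext j e = \sum_(k <- d) conjc (mcoeff k e) *: monom R[i] (j k).
  move=> le; rewrite [LHS](big_fset_incl _ le) => //= k _ /mcoeff_outdom ->.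
  by rewrite conjc0 scale0r.
rewrite !Ew ?fsubsetUl //; last 2 first.
- by rewrite /d; apply/fsubsetP => k; rewrite !inE => ->; rewrite !orbT.
- by rewrite /d; apply/fsubsetP => k; rewrite !inE => ->; rewrite !orbT.
rewrite scaler_sumr -big_split /=; apply: eq_bigr => k _.
by rewrite (@mcoeffD K _) (@mcoeffZ K _) rmorphD rmorphM scalerDl scalerA.
Qed.

Lemma star_ext0 : star_ext j 0 = 0.
Proof. by rewrite /star_ext msupp0 big_seq_fset0. Qed.

Lemma star_extD a b : star_ext j (a + b) = star_ext j a + star_ext j b.
Proof. by rewrite -[a]scale1r star_ext_antilinear conjc1 !scale1r. Qed.

Lemma star_extZ c a : star_ext j (c *: a) = conjc c *: star_ext j a.
Proof. by rewrite -[c *: a]addr0 star_ext_antilinear star_ext0 addr0. Qed.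

Lemma star_ext_sum (I : Type) (r : seq I) (F : I -> monoid_algebra R[i] K) :
  star_ext j (\sum_(i <- r) F i) = \sum_(i <- r) star_ext j (F i).
Proof. exact: (big_morph _ star_extD star_ext0). Qed.

Lemma star_ext_monom k : star_ext j (monom R[i] k) = monom R[i] (j k).
Proof.
rewrite /star_ext [in X in X = _]monomE (msuppU1 R[i] k) big_seq_fset1 mcoeffUU conjc1.
exact: scale1r.
Qed.

Lemma star_extK : involutive j -> involutive (star_ext j).
Proof.
move=> jK a; rewrite [in RHS](malg_monomE a) [X in star_ext j X]/star_ext.
rewrite star_ext_sum; apply: eq_bigr => k _.
by rewrite star_extZ conjcK star_ext_monom jK.
Qed.

Lemma star_extM : (forall k l, j (mmul k l) = mmul (j l) (j k)) ->
  forall a b, star_ext j (a * b) = star_ext j b * star_ext j a.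
Proof.
move=> jM a b.
have -> : a * b = \sum_(k <- msupp a) \sum_(l <- msupp b)
    (mcoeff k a * mcoeff l b) *: monom R[i] (mmul k l).
  rewrite [LHS]malgME; apply: eq_bigr => k _; apply: eq_bigr => l _.
  by rewrite monomE mkmalgUZ mulr1.
rewrite star_ext_sum [X in _ = _ * X]/star_ext [RHS]mulr_sumr.
apply: eq_bigr => k _; rewrite star_ext_sum [X in _ = X * _]/star_ext.
rewrite [RHS]mulr_suml; apply: eq_bigr => l _.
rewrite star_extZ star_ext_monom jM monomM rmorphM.
by rewrite -[RHS]scalerAl -[X in _ = _ *: X]scalerAr [RHS]scalerA mulrC.
Qed.

End Star.

Section NcpolyStar.
Variable R : realType.

Definition pmon_rev (I : choiceType) (m : pmonom I) : pmonom I :=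
  pmon (rev (val m)).

Lemma reduce_rev (I : choiceType) (s : seq (option I)) :
  reduce (rev s) = rev (reduce s).
Proof.
have rP (t : seq (option I)) : reduced t -> reduced (rev t).
  move=> tP; rewrite /reduced rev_sorted; apply: sub_sorted tP => a b /=.
  by rewrite orbC.
elim: s => //= a s IHs; rewrite rev_cons -cats1 -reduce_catl {}IHs.
have := reduced_pcons a (reduced_reduce s).
move: (reduce s) (reduced_reduce s) => r rr.
have [-> ar|[-> [q rE]] _] : pcons a r = a :: r \/
    a = None /\ exists q, r = None :: q.
- by case: a r {rr} => [a|] [|[b|] r]; try (by left); right; split=> //; exists r.
- by rewrite reduce_id cats1 -rev_cons ?rP.
have -> : pcons None r = r by rewrite rE.
rewrite -[in RHS](reduce_id (rP r rr)) rE rev_cons -cats1 -catA.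
by rewrite !reduce_cat.
Qed.

Lemma pmon_revK (I : choiceType) : involutive (@pmon_rev I).
Proof.
move=> m; apply: val_inj; rewrite /= !reduce_rev revK.
by rewrite !reduce_id // ?(valP m).
Qed.

Lemma pmon_revM (I : choiceType) (m n : pmonom I) :
  pmon_rev (mmul m n) = mmul (pmon_rev n) (pmon_rev m).
Proof.
apply: val_inj; rewrite /= reduce_catl reduce_catr -rev_cat !reduce_rev.
by rewrite reduce_id ?reduced_reduce.
Qed.

(* The involution for which the Y_i and P are self-adjoint. *)
Definition ncstar (I : choiceType) : ncpoly R[i] I -> ncpoly R[i] I :=
  star_ext (@pmon_rev I).

Lemma ncstar_var (I : choiceType) (x : I) : ncstar (ncvar x) = ncvar x.
Proof. by rewrite /ncstar star_ext_monom; congr monom; apply: val_inj. Qed.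

Lemma ncstar_proj (I : choiceType) : ncstar (ncproj : ncpoly R[i] I) = ncproj.
Proof. by rewrite /ncstar star_ext_monom; congr monom; apply: val_inj. Qed.

Lemma ncstar1 (I : choiceType) : ncstar (1 : ncpoly R[i] I) = 1.
Proof. by rewrite -monom1 /ncstar star_ext_monom; congr monom; apply: val_inj. Qed.

Definition bialg2_star : bialg2 R[i] -> bialg2 R[i] :=
  star_ext (fun kl => (pmon_rev kl.1, pmon_rev kl.2)).

Lemma bialg2_star_tens (a b : bialg R[i]) :
  bialg2_star (tens a b) = tens (ncstar a) (ncstar b).
Proof.
have sE e : ncstar e =
    \sum_(k <- msupp e) conjc (mcoeff k e) *: monom R[i] (pmon_rev k) by [].
rewrite tensE /bialg2_star star_ext_sum !sE tens_suml; apply: eq_bigr => k _.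
rewrite star_ext_sum tensZl [X in _ *: X]linear_sum scaler_sumr.
apply: eq_bigr => l _.
by rewrite star_extZ star_ext_monom linearZ /= tens_monom scalerA rmorphM.
Qed.

Lemma ncmorph_star (I : choiceType) (K : MonomialDef.type) (j : K -> K)
    (x : I -> monoid_algebra R[i] K) (p : monoid_algebra R[i] K) :
    j mone = mone -> (forall k l, j (mmul k l) = mmul (j l) (j k)) ->
    p * p = p -> (forall i, star_ext j (x i) = x i) -> star_ext j p = p ->
  forall a, ncmorph x p (ncstar a) = star_ext j (ncmorph x p a).
Proof.
move=> j1 jM pp xs ps a.
have -> : ncmorph x p (ncstar a) = \sum_(m <- msupp a)
    conjc (mcoeff m a) *: ncmorph x p (monom R[i] (pmon_rev m)).
  apply: (etrans (linear_sum (lin_ext _) _ _ _)); apply: eq_bigr => m _.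
  exact: (linearZ_LR (lin_ext _)).
rewrite {2}/ncmorph lin_extE star_ext_sum; apply: eq_bigr => m _.
rewrite star_extZ (ncmorph_pmon _ pp); congr (_ *: _).
elim: (val m) => [|b s IHs]; first by rewrite !big_nil -monom1 star_ext_monom j1.
rewrite rev_cons -cats1 big_cat big_seq1 big_cons (star_extM jM) IHs /=.
by case: b => [b|] /=; rewrite ?xs ?ps.
Qed.

Lemma coproduct_star (a : bialg R[i]) :
  coproduct (ncstar a) = bialg2_star (coproduct a).
Proof.
have sD (b c : bialg2 R[i]) :
    bialg2_star (b + c) = bialg2_star b + bialg2_star c by exact: star_extD.
have xs x : bialg2_star (coproduct_gen R[i] x) = coproduct_gen R[i] x.
  by case: x; rewrite sD !bialg2_star_tens ncstar_var ?ncstar1 ?ncstar_proj.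
have ps : bialg2_star (tens ncproj ncproj) = tens ncproj ncproj.
  by rewrite bialg2_star_tens ncstar_proj.
apply: ncmorph_star => [|k l||x|].
- by congr pair; apply: val_inj.
- by congr pair; apply: pmon_revM.
- exact: coproduct_proj_idem.
- exact: xs.
- exact: ps.
Qed.

Lemma eta_star (a : bialg R[i]) : eta (ncstar a) = ncstar (eta a).
Proof.
apply: ncmorph_star => [|k l||i|].
- exact: val_inj.
- exact: pmon_revM.
- exact: ncproj_idem.
- exact: ncstar_var.
- exact: ncstar_proj.
Qed.

End NcpolyStar.

Section MeasureStates.
Variables (R : realType) (mu : probability (measurableTypeR R) R).

Definition finite_moments :=
  forall n : nat, mu.-integrable [set: R]%classic (fun x : R => (x ^+ n)%:E).

Definition moment (n : nat) : R := (\int[mu]_x (x ^+ n))%R.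

(* The functional on C[Y] with value [moment n] at Y ^ n. *)
Definition measure_fun (p : {poly R[i]}) : R[i] :=
  \sum_(n < size p) p`_n * (moment n)%:C%C.

(* The boolean extension of [measure_fun], composed with [eta]. *)
Definition hat : bialg R[i] -> R[i] := boolean_ext measure_fun \o @eta R[i].

Lemma measure_funXn n : measure_fun 'X^n = (moment n)%:C%C.
Proof.
rewrite /measure_fun size_polyXn big_ord_recr /= coefXn eqxx mul1r.
rewrite big1 ?add0r // => i _; rewrite coefXn ltn_eqF ?mul0r //; exact: ltn_ord.
Qed.

Lemma measure_fun1 : measure_fun 1 = 1.
Proof.
rewrite -(expr0 'X) measure_funXn /moment /Rintegral.
under eq_integral do rewrite expr0.
rewrite integral_cst // mul1e -[RHS]/((fine (1%:E : \bar R))%:C)%C.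
congr ((fine _)%:C)%C; exact: probability_setT.
Qed.

Lemma moment_of_hat (s : seq letter) : moment_of hat s = (moment (size s))%:C%C.
Proof.
have etaE : eta (\prod_(x <- s) ncvar x) = ncvar tt ^+ size s :> ncpolyY R[i].
  elim: s => [|x s IHs]; first by rewrite big_nil rmorph1.
  rewrite big_cons rmorphM /= IHs exprS; congr (_ * _).
  by apply: ncmorph_var; apply: ncproj_idem.
have := boolean_extE measure_fun1 false false (size s) [::].
rewrite !big_nil expr0 mul1r !mulr1 measure_funXn => <-.
by rewrite /moment_of /hat /= etaE.
Qed.

End MeasureStates.

(* Main.v *)
Require Import Defs.
From mathcomp Require Import all_classical all_reals all_analysis.
From mathcomp Require Import all_boot all_order all_algebra.

(* For a set A of positions of s let F_L(A) be the sum of prod_b L(b) over the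
   set partitions of A none of whose blocks b has an inner letter w of s outside
   b.  Expanding products of L_mu + L_nu over colourings of the blocks gives
     F_(L_mu + L_nu)([n]) = sum_A F_(L_mu)(A) F_(L_nu)([n] \ A).
   A letter w outside A cannot be inner to any block, so F_L(A) factors at these
   letters, and on each piece it is a moment by the moment-cumulant formula.
   On the other side, Delta(X(s_1)) ... Delta(X(s_n)) expands as a sum over A of
   simple tensors whose first leg has the variables in A and a P at each w
   outside A (and symmetrically for the second leg), and a boolean extension
   factors at the letters P.  Hence L_mu + L_nu solves the moment-cumulant
   recursion of the convolution, which determines the cumulants. *)

Set Implicit Arguments.
Unset Strict Implicit.
Unset Printing Implicit Defensive.

Import GRing.Theory.

Local Open Scope ring_scope.

(** * First and last indices, and inner positions *)

Section Index.
Variable n : nat.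
Implicit Types (A B : {set 'I_n}) (i j : 'I_n).

Lemma first_index_le A i : i \in A -> (first_index A <= i)%N.
Proof.
move=> iA; rewrite /first_index.
elim: (index_enum _) (mem_index_enum i) => // k r IHr.
rewrite big_cons inE => /predU1P[<-|/IHr le]; first by rewrite iA geq_minl.
by case: ifP => // _; rewrite geq_min le orbT.
Qed.

(** The empty set is no exception: its first index is [n], which no position exceeds. *)
Lemma first_indexP A j :
  reflect (exists2 i, i \in A & (i < j)%N) (first_index A < j)%N.
Proof.
apply: (iffP idP) => [|[i iA ij]]; last first.
  exact: leq_ltn_trans (first_index_le iA) ij.
apply: contraPP => noi; apply/negP; rewrite -leqNgt /first_index.
apply: (big_ind (fun m => j <= m)%N) => [|x y jx jy|i iA].
- exact: ltnW.
- by rewrite leq_min jx.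
- by rewrite leqNgt; apply/negP => ij; apply: noi; exists i.
Qed.

Lemma last_indexP A j :
  reflect (exists2 i, i \in A & (j < i)%N) (j < last_index A)%N.
Proof.
apply: (iffP idP) => [|[i iA ij]]; last first.
  by apply: (leq_trans ij); apply: (leq_bigmax_cond (F := @nat_of_ord n)).
apply: contraPP => noi; apply/negP; rewrite -leqNgt.
apply/bigmax_leqP => i iA; rewrite leqNgt.
by apply/negP => ij; apply: noi; exists i.
Qed.

Lemma innerP j A : reflect
  [/\ j \notin A, exists2 i, i \in A & (i < j)%N & exists2 i, i \in A & (j < i)%N]
  (inner j A).
Proof.
apply: (iffP and3P) => -[jA].
  by move=> /first_indexP ? /last_indexP.
by move=> /first_indexP ? /last_indexP.
Qed.

Lemma first_index_mem A : A != set0 -> exists2 i, i \in A & first_index A = i.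
Proof.
case/set0Pn => i0 i0A; have [i iA mini] := arg_minnP (@nat_of_ord n) i0A.
exists i => //; apply/eqP; rewrite eqn_leq first_index_le //=.
apply: (big_ind (fun m => i <= m)%N) => [|x y ix iy|//]; first exact: ltnW.
by rewrite leq_min ix.
Qed.

(** A nonempty block contains its first index, and disjoint blocks share no point. Hence ordering
    blocks by first index is strict. *)
Lemma first_index_inj (P : {set {set 'I_n}}) : trivIset P -> set0 \notin P ->
  {in P &, injective (@first_index n)}.
Proof.
move=> /trivIsetP tP P0 A B AP BP eAB; apply/eqP; apply: contraTT isT => nAB.
have A0 : A != set0 by apply: contraNneq P0 => <-.
have B0 : B != set0 by apply: contraNneq P0 => <-.
have [i iA iE] := first_index_mem A0; have [j jB jE] := first_index_mem B0.
have ij : i = j by apply: val_inj; rewrite /= -iE -jE.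
have := disjointFr (tP _ _ AP BP nAB) iA; by rewrite ij jB.
Qed.

End Index.

(** * General facts on enumerations and set partitions *)

Lemma sorted_enum_set n (A : {set 'I_n}) : sorted (relpre val ltn) (enum A).
Proof.
rewrite {1}/enum_mem; apply: sorted_filter; first by move=> ? ? ?; apply: ltn_trans.
rewrite -enumT -sorted_map val_enum_ord; exact: iota_ltn_sorted.
Qed.

(** The last hypothesis makes [A] a union of blocks: the block of a point of [A] meets [A], so it
    lies in [A]. *)
Lemma partition_restrict (T : finType) (P : {set {set T}}) (D A : {set T}) :
  partition P D -> A \subset D ->
  (forall b, b \in P -> (b \subset A) || [disjoint b & A]) ->
  partition (P ::&: A) A.
Proof.
move=> Ppart AD Psat; apply/and3P; split; last 2 first.
- exact/trivIsetI/(partition_trivIset Ppart).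
- by rewrite inE (partition0 Ppart).
rewrite eqEsubset (subset_trans (cover_setI _ _)) ?subsetIr //=.
apply/subsetP => x xA; have xP : x \in cover P.
  by rewrite (cover_partition Ppart) (subsetP AD).
have xb : x \in pblock P x by rewrite mem_pblock.
apply/bigcupP; exists (pblock P x) => //; rewrite inE pblock_mem //=.
by case/orP: (Psat _ (pblock_mem xP)) => // /disjointFr/(_ xb); rewrite xA.
Qed.

Lemma partitionU (T : finType) (P Q : {set {set T}}) (A B : {set T}) :
  partition P A -> partition Q B -> [disjoint A & B] ->
  partition (P :|: Q) (A :|: B).
Proof.
move=> PA QB dAB; apply/and3P; split.
- by rewrite /cover bigcup_setU -!/(cover _) (cover_partition PA) (cover_partition QB).
- apply: trivIsetU (partition_trivIset PA) (partition_trivIset QB) _.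
  by rewrite !(cover_partition PA, cover_partition QB).
- by rewrite inE (partition0 PA) (partition0 QB).
Qed.

(** * Sums over unordered admissible partitions *)

Section PartitionSums.
Variables (C : comNzRingType) (s : seq letter).
Implicit Types (A B b : {set 'I_(size s)}) (P Q : {set {set 'I_(size s)}}).
Implicit Types L : seq letter -> C.

(** Here [j] runs over all positions of [s], also those outside the set to be partitioned. *)
Definition admissible_block b := [forall j, (tnth (in_tuple s) j == Lw) ==> ~~ inner j b].

Definition adm_partition A : {set {set {set 'I_(size s)}}} :=
  [set P | partition P A && [forall b in P, admissible_block b]]%SET.

Definition part_sum L A : C :=
  \sum_(P in adm_partition A) \prod_(b in P) L (subword b).

Lemma AP_partition p (u : p.-tuple {set 'I_(size s)}) : (u \in AP s p) =
  ([set:: u] \in adm_partition setT)%SET && sorted (relpre (@first_index _) ltn) u.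
Proof.
rewrite !inE /admissible /is_partition andbAC; congr (_ && _ && _).
by apply/allP/forall_inP => H b; move: (H b); rewrite inE.
Qed.

(** A set partition has exactly one listing by increasing first index, and it has between 1 and
    [size s] blocks, so summing over [p] reaches each partition once. *)
Lemma AP_sum L : s <> [::] ->
  \sum_(1 <= p < (size s).+1) \sum_(u in AP s p)
    \prod_(l < p) L (subword (tnth u l)) = part_sum L setT.
Proof.
move=> s0; have s_gt0 : (0 < size s)%N by case: s s0.
have tr : transitive (relpre (@first_index (size s)) ltn).
  by move=> ? ? ?; apply: ltn_trans.
have irr : irreflexive (relpre (@first_index (size s)) ltn) by move=> ?; apply: ltnn.
transitivity (\sum_(1 <= p < (size s).+1)
    \sum_(P in adm_partition setT | #|P| == p) \prod_(b in P) L (subword b)).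
  apply: eq_bigr => p _.
  pose h (u : p.-tuple {set 'I_(size s)}) := [set:: u]%SET.
  have hinj : {in AP s p &, injective h}.
    move=> u v; rewrite !AP_partition => /andP[_ us] /andP[_ vs] /setP uv.
    apply: val_inj; apply: (irr_sorted_eq tr irr) => // b.
    by have := uv b; rewrite !inE.
  rewrite -[RHS]big_set.
  rewrite (_ : finset _ = h @: AP s p)%SET.
    rewrite big_imset //=; apply: eq_bigr => u.
    rewrite AP_partition => /andP[_ /(sorted_uniq tr irr) uu].
    rewrite -(big_tuple _ _ u xpredT (fun b => L (subword b))) big_uniq //=.
    by apply: eq_bigl => b; rewrite inE.
  apply/setP => P; rewrite inE; apply/andP/imsetP => [[Padm /eqP Pp]|[u uAP ->]].
    have := Padm; rewrite inE => /andP[/and3P[_ tP P0] _].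
    pose r := sort (relpre (@first_index _) leq) (enum P).
    have rsz : size r == p by rewrite size_sort -cardE Pp.
    have rP : [set:: r]%SET = P.
      by apply/setP => b; rewrite inE mem_sort mem_enum.
    exists (Tuple rsz); last by rewrite /h /= rP.
    rewrite AP_partition /= rP Padm /=.
    (* Strictly sorted means weakly sorted with distinct first indices; disjointness of the blocks
       gives the latter. *)
    rewrite -sorted_map ltn_sorted_uniq_leq.
    rewrite sorted_map sort_sorted ?andbT; last by move=> ? ?; apply: leq_total.
    rewrite map_inj_in_uniq ?sort_uniq ?enum_uniq // => A B.
    rewrite !mem_sort !mem_enum; exact: first_index_inj.
  move: uAP; rewrite AP_partition => /andP[uadm /(sorted_uniq tr irr) uu].
  split=> //; rewrite cardsE (card_uniqP uu) size_tuple //.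
have card_le P : partition P setT -> (0 < #|P| <= size s)%N.
  move=> Ppart; apply/andP; split.
    rewrite card_gt0; apply: contraTneq Ppart => ->.
    rewrite /partition /cover big_set0.
    by apply/negP => /and3P[/eqP/setP/(_ (Ordinal s_gt0))]; rewrite !inE.
  rewrite -[leqRHS](card_ord (size s)) -cardsT (card_partition Ppart).
  rewrite -sum1_card; apply: leq_sum => b bP.
  by rewrite card_gt0 (partition_neq0 Ppart).
rewrite big_geq_mkord /part_sum.
(* Partitions are grouped by number of blocks; [inord] keeps that number because it is at most
   [size s]. *)
rewrite [RHS](partition_big (fun P => inord #|P| : 'I_(size s).+1) (fun p => 0 < p)%N) /=.
  apply: eq_bigr => p _; apply: eq_bigl => P.
  case Padm: (P \in _) => //=.
  have := Padm; rewrite inE => /andP[/card_le/andP[_ le] _].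
  by rewrite -val_eqE /= inordK.
by move=> P; rewrite inE => /andP[/card_le/andP[gt le] _]; rewrite inordK.
Qed.

(** A pair of partitions of [A] and [B] amounts to their union, a partition of the union with every
    block inside [A] or [B]. Blocks are nonempty, so none lies in both, and the pair can be read off
    again. *)
Lemma part_sum_mul L1 L2 A B : [disjoint A & B] ->
  part_sum L1 A * part_sum L2 B =
  \sum_(P in adm_partition (A :|: B) |
        [forall b in P, (b \subset A) || (b \subset B)])
    \prod_(b in P) (if b \subset A then L1 (subword b) else L2 (subword b)).
Proof.
move=> dAB; rewrite /part_sum big_distrlr /= pair_big /=.
rewrite [RHS](reindex_onto (fun p => p.1 :|: p.2)%SET
  (fun P => (P ::&: A, P ::&: B))) /=; last first.
  move=> P /andP[_ /forall_inP PAB]; apply/setP => b; rewrite !inE -andb_orr.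
  by case bP: (b \in P) => //=; apply: PAB.
have sub_meet b (D E : {set _}) : [disjoint D & E] -> b != set0 -> b \subset D ->
    (b \subset E) = false.
  move=> dDE /set0Pn[x xb] bD; apply: contraTF isT => bE.
  by have := disjointFr dDE (subsetP bD x xb); rewrite (subsetP bE).
have dBA : [disjoint B & A] by rewrite disjoint_sym.
apply: eq_big => [[Q R] /=|[Q R] /=].
  apply/andP/andP => [[]|[/andP[]]].
    rewrite !inE => /andP[Qpart /forall_inP Qadm] /andP[Rpart /forall_inP Radm].
    split; first rewrite partitionU //; first (apply/andP; split).
    - apply/forall_inP => b; rewrite inE => /orP[]; [exact: Qadm|exact: Radm].
    - apply/forall_inP => b; rewrite inE => /orP[/(partitionS Qpart) ->//|].
      by move=> /(partitionS Rpart) ->; rewrite orbT.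
    apply/eqP; congr pair; apply/setP => b; rewrite !inE.
    - case bQ: (b \in Q) => /=; first exact: (partitionS Qpart).
      case bR: (b \in R) => //=; apply: sub_meet dBA _ _.
        exact: partition_neq0 Rpart bR.
      exact: partitionS Rpart bR.
    - rewrite orbC; case bR: (b \in R) => /=; first exact: (partitionS Rpart).
      case bQ: (b \in Q) => //=; apply: sub_meet dAB _ _.
        exact: partition_neq0 Qpart bQ.
      exact: partitionS Qpart bQ.
  rewrite !inE => /andP[part /forall_inP admU] /forall_inP sat /eqP[QE RE].
  rewrite -[in partition Q A]QE -[in partition R B]RE.
  split; (apply/andP; split).
  - apply: partition_restrict part _ _; first exact: subsetUl.
    move=> b /sat /orP[->//|bB]; apply/orP; right.
    by rewrite disjoint_sym; apply: disjointWr bB dAB.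
  - by apply/forall_inP => b bQ; apply: admU; rewrite inE bQ.
  - apply: partition_restrict part _ _; first exact: subsetUr.
    move=> b /sat /orP[bA|->//]; apply/orP; right.
    exact: disjointWl bA dAB.
  - by apply/forall_inP => b bR; apply: admU; rewrite inE bR orbT.
move=> /andP[]; rewrite !inE => /andP[Qpart _] /andP[Rpart _].
rewrite [RHS](big_setID Q) /= setUK setDUl setDv set0U.
congr (_ * _).
  by apply: eq_bigr => b bQ; rewrite (partitionS Qpart).
apply: eq_big => [b|b bR]; last first.
  rewrite (sub_meet _ _ _ dBA) ?(partitionS Rpart) //.
  exact: partition_neq0 Rpart bR.
rewrite inE; case bQ: (b \in Q) => //=; apply: contraTF isT => bR.
have := sub_meet b _ _ dAB (partition_neq0 Qpart bQ) (partitionS Qpart bQ).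
by rewrite (partitionS Rpart).
Qed.

(* A term of the expanded product colours each block of P by L1 or L2; A is the
   union of the blocks coloured L1. *)
Lemma part_sumD L1 L2 :
  part_sum (fun t => L1 t + L2 t) [set: 'I_(size s)]%SET =
  \sum_(A : {set 'I_(size s)}) part_sum L1 A * part_sum L2 (~: A)%SET.
Proof.
under [RHS]eq_bigr => A _ do
  rewrite part_sum_mul ?setUCr -?subsets_disjoint ?setCK //.
rewrite (exchange_big_dep (mem (adm_partition setT))) /=; last first.
  by move=> A P _ /andP[].
apply: eq_bigr => P; rewrite inE => PT'; have /andP[Ppart _] := PT'.
(* Each factor is a sum over a colour, so the product becomes a sum over colourings [f] of [P], with
   [true] for [L1] and the fixed value [false] off [P]. *)
under eq_bigr => b _ do
  rewrite -(big_bool _ (fun c => if c then L1 (subword b) else L2 (subword b))).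
rewrite (big_distr_big false) /=.
pose cov (f : {ffun {set 'I_(size s)} -> bool}) :=
  cover [set b in P | f b]%SET.
(* A colouring corresponds to the union of its [true] blocks; conversely a union [A] of blocks
   colours [true] the blocks inside it. *)
rewrite (reindex_onto (fun A => [ffun b => (b \in P) && (b \subset A)]) cov) /=.
  apply: eq_big => [A|A _]; last by apply: eq_bigr => b bP; rewrite ffunE bP.
  rewrite PT' /=; apply/andP/forall_inP => [[_ /eqP AE] b bP|sat].
    apply/orP; case bA: (b \subset A); [by left|right].
    rewrite -disjoints_subset -AE; apply/bigcup_disjointP => c.
    rewrite !inE ffunE => /and3P[cP _ cA].
    apply: (trivIsetP (partition_trivIset Ppart)) => //.
    by apply: contraFneq bA => ->.
  split.
    apply/pffun_onP; split=> //; apply/subsetP => b.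
    by rewrite inE ffunE; case: (b \in P).
  rewrite (_ : cov _ = cover (P ::&: A)); last first.
    congr cover; apply/setP => b; rewrite !inE ffunE andbA andbb //.
  rewrite (cover_partition (partition_restrict Ppart (subsetT A) _)) // => b.
  by move=> /sat; rewrite disjoints_subset.
move=> f /pffun_onP[fP _]; apply/ffunP => b; rewrite ffunE.
case bP: (b \in P) => /=; last first.
  apply/esym; apply: contraFF bP => fb; apply: (subsetP fP); rewrite inE fb //.
apply/idP/idP => [|fb]; last by apply: bigcup_max (subxx b); rewrite inE bP.
have /set0Pn[x xb] := partition_neq0 Ppart bP.
move=> /subsetP/(_ x xb)/bigcupP[c]; rewrite inE => /andP[cP fc] xc.
have tP := partition_trivIset Ppart.
by rewrite -(def_pblock tP bP xb) (def_pblock tP cP xc).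
Qed.

End PartitionSums.

(** * Transport of partition sums along an embedding of words *)

Section Embedding.
Variables (s t : seq letter) (f : 'I_(size t) -> 'I_(size s)).
Hypothesis f_homo : {homo f : i j / (i < j)%N}.
Hypothesis f_letter : forall i, tnth (in_tuple s) (f i) = tnth (in_tuple t) i.

Let f_mono : {mono f : i j / (i < j)%N}.
Proof.
move=> i j; apply/idP/idP => [|/f_homo//]; apply: contraLR; rewrite -!leqNgt.
by rewrite leq_eqVlt => /predU1P[/val_inj->//|/f_homo/ltnW].
Qed.

Let f_inj : injective f.
Proof.
move=> i j ij; apply: val_inj; apply/eqP; rewrite eqn_leq leqNgt [X in _ && X]leqNgt.
by rewrite -(f_mono i j) -(f_mono j i) ij ltnn.
Qed.

Lemma subword_imset (b : {set 'I_(size t)}) : subword (f @: b)%SET = subword b.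
Proof.
rewrite /subword (_ : enum _ = map f (enum b)); last first.
  apply: (@irr_sorted_eq _ (relpre val ltn)) => [? ? ?||||i].
  - exact: ltn_trans.
  - by move=> ?; apply: ltnn.
  - exact: sorted_enum_set.
  - by rewrite sorted_map (eq_sorted (e' := relpre val ltn)) ?sorted_enum_set.
  - rewrite mem_enum; apply/imsetP/mapP => -[j jb ->]; exists j => //.
      by rewrite mem_enum.
    by rewrite -mem_enum.
by rewrite -map_comp; apply: eq_map => i; apply: f_letter.
Qed.

Lemma inner_imset j (b : {set 'I_(size t)}) : inner (f j) (f @: b)%SET = inner j b.
Proof.
apply/innerP/innerP => -[]; rewrite (mem_imset _ _ f_inj) => jb.
  move=> [_ /imsetP[i ib ->] ij] [_ /imsetP[k kb ->] jk].
  by split=> //; [exists i|exists k] => //; rewrite -f_mono.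
move=> [i ib ij] [k kb jk].
by split=> //; [exists (f i)|exists (f k)]; rewrite ?f_mono // imset_f.
Qed.

(** By hypothesis only letters z can lie outside the image and inside its span, so [s] puts no
    condition on the image of a block that [t] does not put on the block. *)
Lemma part_sum_imset (C : comNzRingType) (L : seq letter -> C) :
  (forall j, tnth (in_tuple s) j = Lw -> ~~ inner j (f @: setT)%SET) ->
  part_sum L (f @: setT)%SET = part_sum L [set: 'I_(size t)]%SET.
Proof.
move=> noinner; pose g (P : {set {set 'I_(size t)}}) := ((fun b : {set 'I_(size t)} => f @: b) @: P)%SET.
have fs_inj := imset_inj f_inj; have g_inj : injective g := imset_inj fs_inj.
have admE (b : {set 'I_(size t)}) : admissible_block (f @: b)%SET = admissible_block b.
  apply/forallP/forallP => [badm j|badm j].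
    by rewrite -inner_imset -f_letter.
  apply/implyP => /eqP jw; have [/imsetP[i _ ji]|jT] := boolP (j \in f @: setT)%SET.
    by have := badm i; rewrite ji inner_imset -f_letter -ji jw.
  apply/negP => /innerP[_ [_ /imsetP[i _ ->] ij] [_ /imsetP[k _ ->] jk]].
  move/negP: (noinner j jw); apply; apply/innerP; split=> //; [exists (f i)|exists (f k)] => //.
    exact: imset_f.
  exact: imset_f.
have -> : part_sum L (f @: setT)%SET =
    \sum_(P in (g @: adm_partition setT)%SET) \prod_(b in P) L (subword b).
  apply: eq_bigl => P; rewrite inE; apply/andP/imsetP => [[Ppart Padm]|[Q]].
    (* The partition of [t] is recovered by taking preimages of the blocks. *)
    have PE : P = g [set f @^-1: b | b : {set 'I_(size s)} in P]%SET.
      have im_pre b : b \in P -> (f @: (f @^-1: b))%SET = b.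
        move=> /(partitionS Ppart) /subsetP bf.
        apply/setP => i; apply/imsetP/idP => [[j + ->]|ib]; first by rewrite inE.
        by have /imsetP[j _ ij] := bf i ib; exists j => //; rewrite inE -ij.
      apply/setP => b; apply/idP/imsetP => [bP|[_ /imsetP[c cP ->] ->]].
        by exists (f @^-1: b)%SET; rewrite ?im_pre //; apply: imset_f.
      by rewrite im_pre.
    move: Ppart Padm; rewrite PE; set Q := finset.imset _ _.
    rewrite (imset_partition _ _ f_inj) => Qpart Qadm; exists Q => //.
    rewrite inE Qpart; apply/forall_inP => b bQ; rewrite -admE.
    by apply: (forall_inP Qadm); apply: imset_f.
  rewrite inE => /andP[Qpart Qadm] ->; rewrite (imset_partition _ _ f_inj); split=> //.
  by apply/forall_inP => _ /imsetP[b bQ ->]; rewrite admE (forall_inP Qadm).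
rewrite big_imset /=; last by move=> P Q _ _; apply: g_inj.
apply: eq_bigr => P _; rewrite big_imset /=; last by move=> b c _ _; apply: fs_inj.
by apply: eq_bigr => b _; rewrite subword_imset.
Qed.

End Embedding.

(** * Partition sums as moments, and their factorisation at letters w *)

Section Factorisation.
Variables (C : comNzRingType) (s : seq letter).
Implicit Types A : {set 'I_(size s)}.

Lemma part_sum_set0 (L : seq letter -> C) :
  part_sum L (set0 : {set 'I_(size s)}) = 1.
Proof.
rewrite /part_sum (_ : adm_partition _ = [set set0]%SET) ?big_set1 ?big_set0 //.
apply/setP => P; rewrite !inE partition_set0; case: eqP => //= ->.
by apply/forall_inP => b; rewrite inE.
Qed.

(** The increasing enumeration of [A] embeds the word [subword A] in [s]; the moment-cumulant
    formula for that word then gives the value. *)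
Lemma part_sum_moment (M L : seq letter -> C) A : is_cumulants M L ->
  A != set0 -> (forall j, tnth (in_tuple s) j = Lw -> ~~ inner j A) ->
  part_sum L A = M (subword A).
Proof.
move=> ML A0 noinner; have szA := size_subword A.
have sA0 : subword A <> [::].
  by move=> /(congr1 size); rewrite szA => /eqP; rewrite cards_eq0 (negPf A0).
pose f i := enum_val (cast_ord szA i).
have fT : (f @: setT = A)%SET.
  apply/setP => i; apply/imsetP/idP => [[j _ ->]|iA]; first exact: enum_valP.
  exists (cast_ord (esym szA) (enum_rank_in iA i)) => //.
  by rewrite /f cast_ordKV enum_rankK_in.
rewrite (ML _ sA0) AP_sum // -(part_sum_imset (f := f)) ?fT //.
  move=> i j ij; have fE k : f k = nth (f i) (enum A) k by exact: enum_val_nth.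
  have tr : transitive (relpre val ltn : rel 'I_(size s)).
    by move=> ? ? ?; apply: ltn_trans.
  rewrite (fE i) (fE j).
  have := sorted_ltn_nth tr (f i) (sorted_enum_set A).
  by apply; rewrite ?inE -?cardE -?szA.
move=> i; rewrite [RHS](tnth_nth Lz) /= /subword (nth_map (f i)) -?cardE -?szA //.
by rewrite {1}/f (enum_val_nth (f i)).
Qed.

(* An admissible block cannot straddle a letter w outside A, so the partitions
   of the two sides of it are chosen independently. *)
Lemma part_sum_cut (L : seq letter -> C) A j :
  tnth (in_tuple s) j = Lw -> j \notin A ->
  part_sum L A = part_sum L [set i in A | (i < j)%N]%SET *
                 part_sum L [set i in A | (j < i)%N]%SET.
Proof.
move=> jw jA; rewrite part_sum_mul; last first.
  rewrite -setI_eq0; apply/eqP/setP => i; rewrite !inE.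
  by case: ltngtP; rewrite !andbF.
rewrite (_ : (_ :|: _)%SET = A); last first.
  apply/setP => i; rewrite !inE -andb_orr -neq_ltn.
  by case iA: (i \in A) => //=; apply: contraNneq jA => /val_inj <-.
apply: eq_big => [P|P _]; last by apply: eq_bigr => b _; rewrite if_same.
case Padm: (P \in _) => //=; apply/esym/forall_inP => b bP.
move: Padm; rewrite inE => /andP[Ppart /forall_inP/(_ b bP)/forallP/(_ j)].
rewrite jw eqxx /= => /negP bj; have bA := subsetP (partitionS Ppart bP).
have jb : j \notin b by apply: contra jA; apply: bA.
apply: contraT; rewrite negb_or => /andP[/subsetPn[k kb] + /subsetPn[i ib]].
rewrite !inE (bA _ kb) (bA _ ib) /= -!leqNgt => jk ij.
have nej l : l \in b -> val l != j by move=> lb; apply: contraNneq jb => /val_inj<-.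
case: bj; apply/innerP; split=> //; [exists i|exists k] => //.
  by rewrite ltn_neqAle ij nej.
by rewrite ltn_neqAle eq_sym jk nej.
Qed.

End Factorisation.

(** * Partition sums read off from the legs of the coproduct *)

Section LegWord.
Variable s : seq letter.
Implicit Types A : {set 'I_(size s)}.

(* What the letter s_i contributes to the first leg of a term of Delta, when A
   is the set of positions whose variable goes to that leg: the variable if i is
   in A, and otherwise P for the letter w and nothing (a factor 1) for z.  The
   second leg is obtained from the complement of A. *)
Definition leg_letters A (i : 'I_(size s)) : seq (option letter) :=
  if i \in A then [:: Some (tnth (in_tuple s) i)]
  else if tnth (in_tuple s) i is Lw then [:: None] else [::].

Definition leg_word A : seq (option letter) :=
  flatten [seq leg_letters A i | i <- enum 'I_(size s)].

(** The letters P of the leg word sit exactly at the letters w outside [A], where the partition sum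
    factors; the runs between them count the points of [A] in each piece, whose sum is a moment
    depending on that count only. *)
Lemma part_sum_blocks (C : comNzRingType) (L : seq letter -> C) (m : nat -> C) A :
  m 0%N = 1 -> is_cumulants (fun t => m (size t)) L ->
  part_sum L A =
  \prod_(k <- blocks [seq omap (fun=> tt) a | a <- leg_word A]) m k.
Proof.
move=> m0 mL; pose n := size s.
pose range (a b : nat) := [set i in A | (a <= i < b)%N]%SET.
pose word (d : nat) := [seq omap (fun=> tt) a |
  a <- flatten [seq leg_letters A i | i <- drop d (enum 'I_n)]].
have rangeS d (lt_dn : (d < n)%N) b : (d < b)%N ->
    range d b = ((if Ordinal lt_dn \in A then [set Ordinal lt_dn] else set0)
                 :|: range d.+1 b)%SET.
  move=> db; apply/setP => i; rewrite !inE.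
  have [->|ne] := eqVneq i (Ordinal lt_dn).
    by case: ifP => iA; rewrite ?inE ?eqxx //= ?leqnn ?db ?ltnn ?iA.
  rewrite [(d <= i)%N]leq_eqVlt.
  have -> : (d == i) = false.
    by apply/negP => /eqP di; move/eqP: ne; apply; apply: val_inj.
  by case: ifP; rewrite inE ?(negPf ne).
(* [k] is the first position from [d] on of a letter w outside [A], or [n] if
   there is none: there the word of the suffix starting at [d] has its first P. *)
pose cut (d k : nat) := [/\ (d <= k <= n)%N,
    head 0%N (blocks (word d)) = #|range d k|,
    \prod_(l <- behead (blocks (word d))) m l = part_sum L (range k n),
    forall j : 'I_n, (d <= j < k)%N -> tnth (in_tuple s) j = Lw -> j \in A
    & k = n \/ exists2 j : 'I_n, j = k :> nat &
        tnth (in_tuple s) j = Lw /\ j \notin A].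
have cut_prod d k : cut d k ->
    \prod_(l <- blocks (word d)) m l = part_sum L (range d n).
  case=> dkn hE tE kA kw.
  have -> : \prod_(l <- blocks (word d)) m l =
      m (head 0%N (blocks (word d))) * \prod_(l <- behead (blocks (word d))) m l.
    by case: (word d) => [|[[]|] w] /=; rewrite big_cons.
  (* No letter w outside [A] lies between [d] and [k], so this piece is a moment; [m 0 = 1] covers
     the empty piece. *)
  rewrite hE tE; have -> : m #|range d k| = part_sum L (range d k).
    have [->|A0] := eqVneq (range d k) set0; first by rewrite cards0 m0 part_sum_set0.
    rewrite (part_sum_moment mL A0) ?size_subword // => j jw; apply/negP => /innerP[].
    move=> jr [i + ij] [l + jl]; rewrite !inE => /and3P[_ di _] /and3P[_ _ lk].
    have djk : (d <= j < k)%N by rewrite (leq_trans di (ltnW ij)) (ltn_trans jl lk).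
    by move: jr; rewrite inE djk andbT kA.
  have [kn|[j jk [jw jA]]] := kw.
    rewrite kn (_ : range n n = set0) ?part_sum_set0 ?mulr1 //.
    by apply/setP => i; rewrite !inE [(n <= i)%N]leqNgt ltn_ord /= andbF.
  (* As [k] is not in [A], the points of [A] from [k] on are those strictly beyond it. *)
  rewrite (part_sum_cut L jw (A := range d n)); last by rewrite inE negb_and jA.
  congr (_ * _); congr (part_sum _ _); apply/setP => i; rewrite !inE ltn_ord andbT.
    by rewrite -jk -andbA.
  rewrite -jk ltn_neqAle -andbA; case iA: (i \in A) => //=.
  have -> : (j != i) by apply: contraNneq jA => ->.
  case ji: (j <= i)%N; rewrite ?andbF //= !andbT; apply/esym.
  by apply: leq_trans ji; rewrite jk; case/andP: dkn.
(* Induction on the length [e] of the suffix starting at [d]. *)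
suff cutP e d : (d + e)%N = n -> exists k, cut d k.
  have [k /cut_prod] := cutP n 0%N erefl; rewrite /word drop0 => ->.
  congr (part_sum _ _).
  by apply/setP => i; rewrite !inE leq0n ltn_ord !andbT.
elim: e d => [|e IHe] d dn.
  rewrite addn0 in dn; rewrite dn; exists n.
  rewrite /cut /word drop_oversize ?size_enum_ord //=.
  have -> : range n n = set0.
    by apply/setP => i; rewrite !inE [(n <= i)%N]leqNgt ltn_ord /= andbF.
  rewrite leqnn cards0 big_nil part_sum_set0; split=> //; last by left.
  by move=> j; rewrite leqNgt ltn_ord.
have lt_dn : (d < n)%N by rewrite -dn addnS ltnS leq_addr.
pose i := Ordinal lt_dn.
have wordE : word d = [seq omap (fun=> tt) a | a <- leg_letters A i] ++ word d.+1.
  rewrite /word -map_cat (drop_nth i) ?size_enum_ord //=.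
  by rewrite (_ : nth i _ d = i) //; apply: val_inj; rewrite /= nth_enum_ord.
have [|k kcut] := IHe d.+1; first by rewrite addSnnS.
have [/andP[dk kn] hE tE kA kw] := kcut.
have rE := rangeS d lt_dn.
have lt_or (j : 'I_n) : (d <= j)%N -> j = i \/ (d < j)%N.
  by rewrite leq_eqVlt => /predU1P[dj|]; [left; apply: val_inj|right].
(* A position in [A] lengthens the first run by one, and a z outside [A] changes nothing. A w
   outside [A] starts with an empty run: the cut moves to [d], and the previous product becomes the
   tail. *)
case iA: (i \in A).
  exists k; rewrite /cut wordE /leg_letters iA /= (ltnW dk) kn hE tE rE // iA.
  rewrite cardsU1 inE ltnn /= andbF add1n; split=> // j /andP[/lt_or[->//|dj] jk].
  by apply: kA; rewrite dj jk.
case iw: (tnth (in_tuple s) i).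
  exists k; rewrite /cut wordE /leg_letters iA iw /= (ltnW dk) kn hE tE rE // iA set0U.
  split=> // j /andP[/lt_or[->|dj] jk]; first by rewrite iw.
  by apply: kA; rewrite dj jk.
exists d; rewrite /cut wordE /leg_letters iA iw /= leqnn (ltnW lt_dn); split=> //.
- by apply/esym/eqP; rewrite cards_eq0; apply/eqP/setP => j; rewrite !inE ltnNge andbN andbF.
- by rewrite (cut_prod _ _ kcut) rE // iA set0U.
- by move=> j; rewrite ltnNge andbN.
- by right; exists i => //; rewrite iw iA.
Qed.

End LegWord.

(** * Moments of the convolution *)

Section Convolution.
Variable C : comNzRingType.
Implicit Types phi psi : {poly C} -> C.

(** On words, [eta] merges the two variables into Y and keeps P, which is the relabelling by
    [omap]. *)
Lemma boolean_ext_eta phi (w : seq (option letter)) : phi 1 = 1 ->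
  boolean_ext phi (eta (monom C (pmon w))) =
  \prod_(k <- blocks [seq omap (fun=> tt) a | a <- w]) phi 'X^k.
Proof.
move=> phi1; rewrite -boolean_ext_pmon //; congr boolean_ext.
rewrite /eta ncmorph_pmon ?ncproj_idem // monom_pmon big_map.
by apply: eq_bigr => -[].
Qed.

(** A common form for both letters: [c] is what the leg without the variable receives, P for w and
    the empty word for z. *)
Lemma coproduct_genE (x : letter) (c := if x is Lw then [:: None] else [::]) :
  coproduct_gen C x = monom C (pmon [:: Some x], pmon c) +
                      monom C (pmon c, pmon [:: Some x]).
Proof. by rewrite {}/c; case: x; rewrite /= -!tens_monom // !monom1. Qed.

Lemma coproduct_word (s : seq letter) :
  coproduct (\prod_(x <- s) ncvar x : bialg C) =
  \sum_(A : {set 'I_(size s)})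
    monom C (pmon (leg_word A), pmon (leg_word (~: A)%SET)).
Proof.
rewrite rmorph_prod big_tnth.
pose alone i : seq (option letter) := [:: Some (tnth (in_tuple s) i)].
pose away i : seq (option letter) :=
  if tnth (in_tuple s) i is Lw then [:: None] else [::].
transitivity (\prod_i (monom C (pmon (alone i), pmon (away i)) +
                       monom C (pmon (away i), pmon (alone i)))).
  apply: eq_bigr => i _; rewrite -coproduct_genE.
  by apply: ncmorph_var; apply: coproduct_proj_idem.
(* [A] collects the factors whose first summand is chosen, those sending the variable to the first
   leg. *)
rewrite bigA_distr; apply: eq_bigr => A _.
transitivity (\prod_i monom C (pmon (leg_letters A i), pmon (leg_letters (~: A)%SET i))).
  apply: eq_bigr => i _; rewrite /leg_letters inE.
  by case: ifP.
rewrite /leg_word enumT [index_enum _]unlock.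
elim: (Finite.enum _) => [|i r IHr]; first by rewrite big_nil /= -monom1.
by rewrite big_cons {}IHr -monomM /= !pmonM.
Qed.

Lemma moment_of_convolution phi psi (s : seq letter) : phi 1 = 1 -> psi 1 = 1 ->
  moment_of (convolution (boolean_ext phi \o @eta C) (boolean_ext psi \o @eta C)) s =
  \sum_(A : {set 'I_(size s)})
    (\prod_(k <- blocks [seq omap (fun=> tt) a | a <- leg_word A]) phi 'X^k) *
    (\prod_(k <- blocks [seq omap (fun=> tt) a | a <- leg_word (~: A)%SET]) psi 'X^k).
Proof.
move=> phi1 psi1; rewrite /moment_of /convolution /= coproduct_word /tens_fun.
rewrite (linear_sum (lin_ext _)); apply: eq_bigr => A _.
by rewrite /= lin_ext_monom /= !boolean_ext_eta.
Qed.

End Convolution.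

(** * Additivity of the cumulants *)

Lemma cumulantD_boolean_ext (C : comNzRingType) (phi psi : {poly C} -> C)
    (M N : seq letter -> C) (s : seq letter) :
    phi 1 = 1 -> psi 1 = 1 ->
    (forall t, M t = phi 'X^(size t)) -> (forall t, N t = psi 'X^(size t)) ->
    s <> [::] ->
  cumulant (moment_of
    (convolution (boolean_ext phi \o @eta C) (boolean_ext psi \o @eta C))) s =
  cumulant M s + cumulant N s.
Proof.
move=> phi1 psi1 /funext-> /funext-> s0; apply/esym; move: s s0.
apply: (cumulant_unique (L := fun t => _ + _)) => s s0.
apply: etrans (esym (AP_sum (fun t => _ + _) s0)).
(* Both sides are now sums over the same sets [A]; they agree term by term, one factor for each
   leg. *)
rewrite part_sumD moment_of_convolution //; apply: eq_bigr => A _.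
rewrite -(part_sum_blocks (m := fun k => phi 'X^k) A _ (cumulantP _)) //.
by rewrite -(part_sum_blocks (m := fun k => psi 'X^k) (~: A)%SET _ (cumulantP _)).
Qed.

Theorem theorem4p4 (R : realType)
    (mu nu : probability (measurableTypeR R) R)
    (hmu : finite_moments mu) (hnu : finite_moments nu)
    (s : seq letter) (hs : s <> [::]) :
  cumulant (moment_of (convolution (hat mu) (hat nu))) s =
  cumulant (moment_of (hat mu)) s + cumulant (moment_of (hat nu)) s.
Proof.
by apply: cumulantD_boolean_ext => // [||t|t];
  rewrite ?measure_fun1 // moment_of_hat measure_funXn.
Qed.
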